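(* Let $k\geq 1$ be an integer, let $p$ be an odd prime, let $\ell\geq 1$, and let $E\subset(\mathbb{Z}/p^\ell\mathbb{Z})^2$ satisfy $|E|\gtrsim \ell^{\frac{2}{k+1}}p^{\ell s}$, where $s=2-\frac{1}{\ell(k+1)}$. Then $|\mathcal{C}_{k+1}(E)|\gtrsim |\mathcal{C}_{k+1}((\mathbb{Z}/p^\ell\mathbb{Z})^2)|$.
   Context: For a commutative ring $R$ and $x=(x_1,x_2),y=(y_1,y_2)\in R^2$, write $y^\perp=(y_2,-y_1)$, so $x\cdot y^\perp=x_1y_2-x_2y_1$. A $(k+1)$-point configuration is an element $x=(x^1,\dots,x^{k+1})\in (R^2)^{k+1}$. For $E\subset R^2$, define an equivalence relation $\sim$ on $E^{k+1}$ by $x\sim y$ iff $x^i\cdot x^{j\perp}=y^i\cdot y^{j\perp}$ for every pair of indices $i,j$; $\mathcal{C}_{k+1}(E)$ denotes the set of equivalence classes of $E^{k+1}$ under $\sim$. The notation $X\lesssim Y$ (equivalently $Y\gtrsim X$) means $X\leq CY$ for a constant $C$ independent of $p,\ell$ and $E$ (it may depend on $k$); the hypothesis on $|E|$ means $|E|\geq C\ell^{\frac{2}{k+1}}p^{\ell s}$ for a sufficiently large such constant. *)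

(* Defs.v *)
From mathcomp Require Import all_boot all_order all_algebra.
Set Implicit Arguments. Unset Strict Implicit. Unset Printing Implicit Defensive.
Import GRing.Theory.
Local Open Scope ring_scope.

Definition pt (n : nat) := ('Z_n * 'Z_n)%type.

Definition dotperp (n : nat) (x y : pt n) : 'Z_n := x.1 * y.2 - x.2 * y.1.

Definition config (n k : nat) := {ffun 'I_k.+1 -> pt n}.

Definition cfg_equiv (n k : nat) (x y : config n k) : bool :=
  [forall i, forall j, dotperp (x i) (x j) == dotperp (y i) (y j)].

Definition configs (n k : nat) (E : {set pt n}) : {set config n k} :=
  [set x : config n k | [forall i, x i \in E]].

Definition classes (n k : nat) (E : {set pt n}) : {set {set config n k}} :=
  [set [set y in configs k E | cfg_equiv x y] | x in configs k E].

(* Main.v *)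
(** Let [q = p^l] and let [r g] be the number of [x] in [E] with [g x] in [E], for
    [g] in [SL_2(Z/q)].  Two equivalent configurations, one pair of whose points has a
    unit determinant, differ by an element of [SL_2], so by Cauchy-Schwarz the number
    of classes is at least about [|E|^(2k+2) / sum_g (r g)^(k+1)].  The mean of [r] is
    about [m = |E|^2/q^2], and [sum_g (r g - m)^2 <= 3 |E|^2 q^3 / p]: for fixed unit
    [d], expanding the square of [#{y in E : det x y = d}] over all [x] in the plane
    shows that [#{(x, y) in E^2 : det x y = d}] is [|E|^2/q] up to [|E| q / sqrt p],
    while pairs with non-unit determinant are a proportion [1/p] of all pairs.
    The resulting bound on [sum_g (r g)^(k+1)] is of the right order once [|E|^(k+1) >= C q^(2k+2) / p].
    Conversely [Z/q] is a valuation ring, so the determinants of any configuration are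
    [D det(f_i, f_j)] where two of the [f_i] are the standard basis; this leaves at
    most [(k+1)^2 q^(2k-1)] classes. *)

Require Import Defs.
From mathcomp Require Import all_boot all_order all_algebra.
From mathcomp Require Import ring lra zify.
Set Implicit Arguments. Unset Strict Implicit. Unset Printing Implicit Defensive.
Import Order.TTheory GRing.Theory Num.Theory.

(** * Determinants and linear maps of the plane over a commutative ring *)

Section Plane.
Local Open Scope ring_scope.
Variable R : comUnitRingType.
Notation V := (R * R)%type.
Implicit Types (x y z : V) (g : V * V).

Definition det x y : R := x.1 * y.2 - x.2 * y.1.

(* [g] encodes the matrix with columns [g.1] and [g.2], acting on [x]. *)
Definition lincomb g x : V :=
  (x.1 * g.1.1 + x.2 * g.2.1, x.1 * g.1.2 + x.2 * g.2.2).

Lemma det_lincombr x y z : det x (lincomb (x, y) z) = det x y * z.2.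
Proof. by rewrite /det /lincomb /fst /snd; ring. Qed.

Lemma det_lincombl x y z : det (lincomb (x, y) z) y = z.1 * det x y.
Proof. by rewrite /det /lincomb /fst /snd; ring. Qed.

Lemma det_perp x y : det (- x.2, x.1) (- y.2, y.1) = det x y.
Proof. by rewrite /det /fst /snd; ring. Qed.

Lemma det_lincomb g x y :
  det (lincomb g x) (lincomb g y) = det g.1 g.2 * det x y.
Proof. by rewrite /det /lincomb /fst /snd; ring. Qed.

Lemma detC x y : det x y = - det y x.
Proof. by rewrite /det; ring. Qed.

(** Cramer's identity [det x y * z = det z y * x - det z x * y] recovers [z] from its two
    determinants. *)
Lemma det_cancel x y z w : det x y \is a GRing.unit ->
  det z x = det w x -> det z y = det w y -> z = w.
Proof.
case: x y z w => [x1 x2] [y1 y2] [z1 z2] [w1 w2]; rewrite /det /= => u zx zy.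
congr pair; apply: (mulrI u).
  transitivity (y1 * (z1 * x2 - z2 * x1) * -1 + x1 * (z1 * y2 - z2 * y1)); first by ring.
  by rewrite zx zy; ring.
transitivity (y2 * (z1 * x2 - z2 * x1) * -1 + x2 * (z1 * y2 - z2 * y1)); first by ring.
by rewrite zx zy; ring.
Qed.

Lemma lincomb_inj x y g h : det x y \is a GRing.unit ->
  (lincomb g x, lincomb g y) = (lincomb h x, lincomb h y) -> g = h.
Proof.
move=> u [h1 h2 h3 h4].
have P s t s' t' : x.1 * s + x.2 * t = x.1 * s' + x.2 * t' ->
    y.1 * s + y.2 * t = y.1 * s' + y.2 * t' -> (s, t) = (s', t').
  (* The linear form [x.1 * s + x.2 * t] is the determinant of [(s, t)] with [x] turned by a right
     angle. *)
  move=> e1 e2; apply: (@det_cancel (- x.2, x.1) (- y.2, y.1)).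
  - by rewrite det_perp.
  - by move: e1; rewrite /det /= !mulrN !opprK ![_ * x.1]mulrC ![_ * x.2]mulrC.
  - by move: e2; rewrite /det /= !mulrN !opprK ![_ * y.1]mulrC ![_ * y.2]mulrC.
case: g h h1 h2 h3 h4 => [[a b] [c d]] [[a' b'] [c' d']] /= h1 h2 h3 h4.
by have [-> ->] := P _ _ _ _ h1 h3; have [-> ->] := P _ _ _ _ h2 h4.
Qed.

Lemma cramer x y z : det x y = 1 -> lincomb (x, y) (det z y, det x z) = z.
Proof.
move=> xy; apply: (@det_cancel x y); first by rewrite xy unitr1.
  rewrite -[RHS]mul1r -[in RHS]xy /lincomb /det /=; ring.
rewrite -[RHS]mul1r -[in RHS]xy /lincomb /det /=; ring.
Qed.

(** The matrix taking [x], [y] to [x'], [y'] has determinant [det x' y' / det x y = 1], hence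
    preserves all determinants. So [lincomb g z] and [w] have equal determinants against [x'] and
    [y'], and [det_cancel] applies. *)
Lemma unimod_transport x y x' y' : det x y \is a GRing.unit ->
  det x' y' = det x y -> exists2 g, det g.1 g.2 = 1 &
  forall z w, det z x = det w x' -> det z y = det w y' -> lincomb g z = w.
Proof.
move=> u eqd; pose d := det x y.
(* The matrix [(x', y')] is applied to the columns of the inverse of [(x, y)]. *)
pose g : V * V := (lincomb (x', y') (y.2 / d, - x.2 / d),
                   lincomb (x', y') (- y.1 / d, x.1 / d)).
have gx : lincomb g x = x'.
  rewrite [RHS]surjective_pairing -[x'.1]mul1r -[x'.2]mul1r -(divrr u).
  by rewrite /g /lincomb /d /det /=; congr pair; ring.
have gy : lincomb g y = y'.
  rewrite [RHS]surjective_pairing -[y'.1]mul1r -[y'.2]mul1r -(divrr u).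
  by rewrite /g /lincomb /d /det /=; congr pair; ring.
have g1 : det g.1 g.2 = 1.
  by apply: (mulIr u); rewrite -det_lincomb gx gy mul1r.
exists g => // z w zx zy; apply: (@det_cancel x' y'); first by rewrite eqd.
  by rewrite -{1}gx det_lincomb g1 mul1r.
by rewrite -{1}gy det_lincomb g1 mul1r.
Qed.

End Plane.

(** * Lines and determinant one matrices over a finite ring *)

Section FinitePlane.
Local Open Scope ring_scope.
Variable R : finComUnitRingType.
Notation V := (R * R)%type.
Notation q := #|R|.
Notation N := #|[pred d : R | d \isn't a GRing.unit]|.
Implicit Types (x y z : V) (g : V * V) (E : {set V}).

(** Equivalently, the coordinates of [x] generate the unit ideal. This makes each [det x z = d] a
    line with exactly [#|R|] points. *)
Definition primitive x := [exists y, det x y == 1].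

(** In the basis [x], [y] the solutions are the points [t x + d y]. *)
Lemma sum_det_eq x y d (F : V -> nat) : det x y = 1 ->
  (\sum_(z | det x z == d) F z = \sum_(t : R) F (lincomb (x, y) (t, d)))%N.
Proof.
move=> xy; rewrite (reindex_onto (fun t => lincomb (x, y) (t, d)) (fun z => det z y)) /=.
  apply: eq_bigl => t.
  by rewrite det_lincombr det_lincombl xy mul1r mulr1 !eqxx.
by move=> z /eqP <-; apply: cramer.
Qed.

Lemma card_det_eq x d : primitive x -> (\sum_(z | det x z == d) 1 = q)%N.
Proof.
by case/existsP=> y /eqP xy; rewrite (sum_det_eq d (fun=> 1%N) xy) sum1_card.
Qed.

Lemma card_det_eqr x d : primitive x -> (\sum_(z | det z x == d) 1 = q)%N.
Proof.
move=> px; rewrite -(card_det_eq (- d) px).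
by apply: eq_bigl => z; rewrite detC eqr_oppLR.
Qed.

Lemma card_det_nonunit x : primitive x ->
  (\sum_(z | det x z \isn't a GRing.unit) 1 = q * N)%N.
Proof.
move=> px; rewrite (partition_big (det x) (fun d => d \isn't a GRing.unit)) //=.
rewrite mulnC -sum_nat_const; apply: eq_bigr => d nd.
rewrite -(card_det_eq d px); apply: eq_bigl => z.
by apply: andb_idl => /eqP->.
Qed.

Lemma card_units_nonunits : (\sum_(d : R | d \is a GRing.unit) 1 + N = q)%N.
Proof.
rewrite -[N]sum1_card -[q in RHS]sum1_card [RHS](bigID (fun d : R => d \is a GRing.unit)) /=.
by congr addn; apply: eq_bigl.
Qed.

Definition unimod g := det g.1 g.2 == 1.

(** Right multiplication by a determinant one matrix with first column [x] permutes the determinant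
    one matrices and turns [g.1] into [lincomb g x]. *)
Lemma sum_unimod (F : V -> nat) x : primitive x ->
  (\sum_(g | unimod g) F (lincomb g x) = \sum_(g | unimod g) F g.1)%N.
Proof.
case/existsP=> y /eqP xy.
rewrite [RHS](reindex_inj (h := fun g => (lincomb g x, lincomb g y))) /=.
  by apply: eq_bigl => g; rewrite /unimod /= det_lincomb xy mulr1.
by move=> g h; apply: lincomb_inj; rewrite xy unitr1.
Qed.

(** A primitive first column has exactly [q] possible second columns. *)
Lemma sum_unimod_fst (F : V -> nat) : (forall x, ~~ primitive x -> F x = 0%N) ->
  (\sum_(g | unimod g) F g.1 = \sum_x q * F x)%N.
Proof.
move=> F0.
rewrite -(pair_big_dep predT (fun u v => det u v == 1) (fun u v => F u)) /=.
apply: eq_bigr => u _; case: (boolP (primitive u)) => [pu|/F0->]; last by rewrite big1 ?muln0.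
by rewrite sum_nat_const -sum1_card -(card_det_eq 1 pu).
Qed.

Lemma card_unimod : (\sum_(g | unimod g) 1 <= q ^ 3)%N.
Proof.
rewrite -(pair_big_dep predT (fun u v => det u v == 1) (fun u v => 1%N)) /=.
have -> : (q ^ 3 = \sum_(x : V) q)%N.
  by rewrite sum_nat_const card_prod !expnS expn0 muln1 mulnA.
apply: leq_sum => u _; case: (boolP (primitive u)) => [/card_det_eq-> //|/negP np].
rewrite big_pred0 // => v; apply/negP => uv; apply: np; apply/existsP; by exists v.
Qed.

End FinitePlane.

(** * Variance and Cauchy-Schwarz for finite sums *)

Section Sums.
Local Open Scope ring_scope.

Lemma sum_bool (I : finType) (P Q : pred I) :
  (\sum_(i | P i) Q i = \sum_(i | P i && Q i) 1)%N.
Proof. by rewrite big_mkcondr; apply: eq_bigr => i _; case: (Q i). Qed.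

Lemma sum_uniq_le1 (I : finType) (P : pred I) :
  (forall i j, P i -> P j -> i = j) -> (\sum_(i | P i) 1 <= 1)%N.
Proof.
by move=> Pinj; rewrite sum1_card; apply/card_le1_eqP => i j Pi Pj; apply: Pinj.
Qed.

Lemma sum_sqr_center (I : finType) (P : pred I) (f : I -> rat) (c : rat) :
  \sum_(i | P i) (f i - c) ^+ 2 =
  \sum_(i | P i) f i ^+ 2 - 2 * c * \sum_(i | P i) f i
    + c ^+ 2 * (\sum_(i | P i) 1)%:R.
Proof.
rewrite natr_sum !mulr_sumr -sumrB -big_split /=.
by apply: eq_bigr => i _; ring.
Qed.

(** The variance about the mean [S / s] is nonnegative. *)
Lemma cauchy_schwarz_sum (I : finType) (P : pred I) (f : I -> rat) :
  (\sum_(i | P i) f i) ^+ 2 <= (\sum_(i | P i) 1)%:R * \sum_(i | P i) f i ^+ 2.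
Proof.
set s := (\sum_(i | P i) 1)%:R; set S := \sum_(i | P i) f i.
set Q := \sum_(i | P i) _ ^+ 2.
have [s0|s0] := eqVneq s 0.
  rewrite /S big1 ?s0 ?mul0r ?expr0n // => i Pi.
  by move/eqP: s0; rewrite pnatr_eq0 sum_nat_eq0 => /forallP/(_ i); rewrite Pi.
have sp : 0 < s by rewrite lt_def s0 ler0n.
have : 0 <= \sum_(i | P i) (f i - S / s) ^+ 2 by apply: sumr_ge0 => i _; apply: sqr_ge0.
rewrite sum_sqr_center -/Q -/S -/s.
have -> : Q - 2 * (S / s) * S + (S / s) ^+ 2 * s = Q - S ^+ 2 / s by field.
by rewrite subr_ge0 ler_pdivrMr // mulrC.
Qed.

End Sums.

(** * Second moments of determinant counts and of intersections of [E] with its images *)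

Section Variance.
Local Open Scope ring_scope.
Variable R : finComUnitRingType.
Notation V := (R * R)%type.
Notation q := #|R|.
Notation N := #|[pred d : R | d \isn't a GRing.unit]|.
Variable E : {set V}.
Hypothesis E_prim : {in E, forall x, primitive x}.
Implicit Types (x y z : V) (g : V * V).

Definition nu x (d : R) : nat := (\sum_(y in E) (det x y == d))%N.

Lemma sum_nu d : (\sum_x nu x d = #|E| * q)%N.
Proof.
rewrite exchange_big /= -sum_nat_const; apply: eq_bigr => y yE.
by rewrite (sum_bool predT) -(card_det_eqr d (E_prim yE)).
Qed.

(** Since [det x (y / d) = 1], the solutions are [z = t x + y]. Then [det y z = - t d], a non-unit
    exactly when [t] is. *)
Lemma sum_det_eq_nonunit x y d : d \is a GRing.unit -> det x y = d ->
  (\sum_(z | det x z == d) (det y z \isn't a GRing.unit) = N)%N.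
Proof.
move=> ud xy.
have xy0 : det x (y.1 / d, y.2 / d) = 1.
  by rewrite -(divrr ud) -[X in _ = X / _]xy /det /=; ring.
rewrite (sum_det_eq d _ xy0) -sum1_card -(sum_bool predT).
apply: eq_bigr => t _; congr (nat_of_bool (~~ _)).
have -> : det y (lincomb (x, (y.1 / d, y.2 / d)) (t, d)) = - (t * d).
  by rewrite -[in RHS]xy /det /lincomb /=; ring.
by rewrite unitrN unitrMl.
Qed.

(* For [y], [z] with unit determinant at most one [x] satisfies both equations. *)
Lemma sum_nu_sqr d : d \is a GRing.unit ->
  (\sum_x nu x d ^ 2 <= #|E| ^ 2 + #|E| * (q * N))%N.
Proof.
move=> ud.
have -> : (\sum_x nu x d ^ 2 =
    \sum_(y in E) \sum_(z in E) \sum_x (det x y == d) * (det x z == d))%N.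
  under [in RHS]eq_bigr do rewrite exchange_big /=.
  rewrite exchange_big /=; apply: eq_bigr => x _.
  by rewrite -mulnn /nu big_distrlr.
rewrite expnS expn1 -mulnDr -sum_nat_const; apply: leq_sum => y yE.
rewrite -(card_det_eqr d (E_prim yE)) -sum1_card big_distrl /=.
(* The 1 pays for [z] with [det y z] a unit. For the other [z], each of the [q] solutions [x]
   contributes at most [N]. *)
apply: (@leq_trans (\sum_(z in E) (1 +
    \sum_x (det x y == d) * ((det x z == d) * (det y z \isn't a GRing.unit))))%N).
  apply: leq_sum => z _; case: (boolP (det y z \is a GRing.unit)) => u.
    apply: leq_trans (leq_addr _ _).
    rewrite -(big_mkcond (fun x => true)) /=.
    under eq_bigr do rewrite mulnb.
    rewrite (sum_bool predT); apply: sum_uniq_le1 => x w /=.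
    by move=> /andP[/eqP a /eqP b] /andP[/eqP a' /eqP b']; apply: (det_cancel u); congruence.
  apply: leq_trans (leq_addl _ _); apply: leq_sum => x _; by rewrite muln1.
rewrite big_split /= leq_add2l exchange_big /=.
rewrite [X in (_ <= X)%N]big_mkcond /=; apply: leq_sum => x _.
case: eqP => [xy|_]; last by rewrite big1 // => z _; rewrite mul0n.
rewrite mul1n -(sum_det_eq_nonunit ud xy).
under eq_bigr do rewrite mul1n.
rewrite big_mkcond [X in (_ <= X)%N]big_mkcond /=; apply: leq_sum => z _.
by case: (z \in E); case: (det x z == d) => //; rewrite mul1n.
Qed.

Let e : rat := #|E|%:R.
Let Q : rat := q%:R.
Let M : rat := N%:R.

Lemma card_ring_gt0 : 0 < Q.
Proof. by rewrite ltr0n; apply/card_gt0P; exists 0. Qed.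

(** The mean over the plane is [e / Q]; centering cancels the term [e ^+ 2] of the second moment. *)
Lemma variance_nu d : d \is a GRing.unit ->
  \sum_x ((nu x d)%:R - e / Q) ^+ 2 <= e * Q * M.
Proof.
move=> ud; have Qp := card_ring_gt0.
rewrite sum_sqr_center -natr_sum sum_nu sum1_card card_prod !natrM -/e -/Q.
have : \sum_x ((nu x d)%:R : rat) ^+ 2 <= e ^+ 2 + e * (Q * M).
  move: (sum_nu_sqr ud); rewrite -(ler_nat rat) natrD !natrM natr_sum -expr2.
  by under eq_bigr do rewrite natrX.
have -> : 2 * (e / Q) * (e * Q) = 2 * e ^+ 2 by field; rewrite gt_eqF.
have -> : (e / Q) ^+ 2 * (Q * Q) = e ^+ 2 by field; rewrite gt_eqF.
by lra.
Qed.

Definition nu_tot d : nat := (\sum_(x in E) nu x d)%N.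

(** Cauchy-Schwarz over [E]; the variance over [E] is at most that over the whole plane. *)
Lemma nu_tot_dev d : d \is a GRing.unit ->
  ((nu_tot d)%:R - e ^+ 2 / Q) ^+ 2 <= e ^+ 2 * Q * M.
Proof.
move=> ud; have Qp := card_ring_gt0.
have -> : (nu_tot d)%:R - e ^+ 2 / Q = \sum_(x in E) ((nu x d)%:R - e / Q).
  by rewrite sumrB natr_sum sumr_const -[_ *+ #|E|]mulr_natr -/e; field; rewrite gt_eqF.
apply: le_trans (cauchy_schwarz_sum _ _) _.
rewrite sum1_card -/e expr2 -!mulrA ler_wpM2l ?ler0n // mulrA.
apply: le_trans (variance_nu ud).
rewrite [X in _ <= X](bigID (mem E)) /= lerDl.
by apply: sumr_ge0 => x _; apply: sqr_ge0.
Qed.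

Lemma sum_nu_tot_le : (\sum_d nu_tot d = #|E| ^ 2)%N.
Proof.
rewrite exchange_big /= expnS expn1 -sum_nat_const; apply: eq_bigr => x _.
rewrite exchange_big /= -sum1_card; apply: eq_bigr => y _.
by rewrite (sum_bool predT) (big_pred1 (det x y)) // => d /=; rewrite eq_sym.
Qed.

Lemma card_le_plane : e <= Q ^+ 2.
Proof. by rewrite -natrX ler_nat -mulnn -card_prod max_card. Qed.

(** One error [e ^+ 2 * Q ^+ 2 * M] is the summed deviation. The other arises because there are only
    [Q - M] units, together with [e / Q <= Q]. *)
Lemma sum_nu_tot_sqr :
  \sum_(d : R | d \is a GRing.unit) (nu_tot d)%:R ^+ 2
    <= e ^+ 4 / Q + 2 * e ^+ 2 * Q ^+ 2 * M.
Proof.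
have Qp := card_ring_gt0; have eQ := card_le_plane; have e0 : 0 <= e by rewrite ler0n.
have M0 : 0 <= M by rewrite ler0n.
set U := (\sum_(d : R | d \is a GRing.unit) 1)%N.
have UE : U%:R = Q - M by rewrite -[Q](congr1 (fun k => k%:R) (card_units_nonunits R)) natrD addrK.
have dev : \sum_(d : R | d \is a GRing.unit) ((nu_tot d)%:R - e ^+ 2 / Q) ^+ 2
    <= e ^+ 2 * Q ^+ 2 * M.
  apply: le_trans (ler_sum _ (fun d ud => nu_tot_dev ud)) _.
  have -> : \sum_(d : R | d \is a GRing.unit) e ^+ 2 * Q * M = e ^+ 2 * Q * M * (Q - M).
    by rewrite -UE natr_sum mulr_sumr; apply: eq_bigr => d _; rewrite mulr1.
  have : 0 <= e ^+ 2 * Q * M * M by rewrite !mulr_ge0 ?exprn_ge0 // ltW.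
  lra.
move: dev; rewrite sum_sqr_center -/U UE.
have tot : \sum_(d : R | d \is a GRing.unit) (nu_tot d)%:R <= e ^+ 2.
  rewrite /e -natrX -sum_nu_tot_le -natr_sum ler_nat.
  by rewrite [X in (_ <= X)%N](bigID (fun d : R => d \is a GRing.unit)) leq_addr.
have : e ^+ 2 / Q * (\sum_(d : R | d \is a GRing.unit) (nu_tot d)%:R) <= e ^+ 2 / Q * e ^+ 2.
  by apply: ler_wpM2l => //; rewrite divr_ge0 ?exprn_ge0 // ltW.
have : (e ^+ 2 / Q) ^+ 2 * (Q - M) = e ^+ 4 / Q - e ^+ 2 * M * (e / Q) ^+ 2.
  by field; rewrite gt_eqF.
have : e ^+ 2 * M * (e / Q) ^+ 2 <= e ^+ 2 * M * Q ^+ 2.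
  apply: ler_wpM2l; first by rewrite mulr_ge0 ?exprn_ge0.
  by apply: lerXn2r; rewrite ?nnegrE ?divr_ge0 ?(ltW Qp) // ler_pdivrMr // -expr2.
have -> : e ^+ 2 / Q * e ^+ 2 = e ^+ 4 / Q by field; rewrite gt_eqF.
lra.
Qed.

Definition isect g : nat := (\sum_(x in E) (lincomb g x \in E))%N.

Lemma isect_le g : (isect g <= #|E|)%N.
Proof. by rewrite -sum1_card; apply: leq_sum => x _; case: (_ \in E). Qed.

Lemma sum_unimod_mem x : primitive x ->
  (\sum_(g | unimod g) (lincomb g x \in E) = #|E| * q)%N.
Proof.
move=> px; rewrite (sum_unimod (fun y => y \in E : nat) px).
rewrite (sum_unimod_fst (F := fun y => y \in E : nat)).
  rewrite -sum_nat_const [RHS]big_mkcond /=; apply: eq_bigr => y _.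
  by case: (y \in E); rewrite ?muln1 ?muln0.
by move=> y; case: (boolP (y \in E)) => // /E_prim ->.
Qed.

Lemma sum_isect : (\sum_(g | unimod g) isect g = #|E| * (#|E| * q))%N.
Proof.
rewrite exchange_big /= -sum_nat_const; apply: eq_bigr => x xE.
exact: sum_unimod_mem (E_prim xE).
Qed.

(** The map from [g] to the images of [x] and [y] is injective, with values in pairs of the same
    determinant. *)
Lemma sum_unimod_pair_unit x y : det x y \is a GRing.unit ->
  (\sum_(g | unimod g) (lincomb g x \in E) * (lincomb g y \in E)
    <= nu_tot (det x y))%N.
Proof.
move=> u; under eq_bigr do rewrite mulnb.
rewrite sum_bool sum1dep_card.
have -> : nu_tot (det x y) =
    #|[set p : V * V | [&& p.1 \in E, p.2 \in E & det p.1 p.2 == det x y]]|.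
  rewrite -sum1dep_card /nu_tot /nu pair_big_dep /= sum_bool.
  by apply: eq_bigl => p; rewrite andbA.
rewrite -(card_in_imset (f := fun g => (lincomb g x, lincomb g y))).
  apply/subset_leq_card/subsetP => p /imsetP[g]; rewrite inE => /and3P[/eqP g1 gx gy] ->.
  by rewrite inE /= gx gy det_lincomb g1 mul1r eqxx.
by move=> g h _ _ /(lincomb_inj u).
Qed.

(** Expand the square over pairs [x], [y] in [E]. Those of unit determinant [d] number [nu_tot d],
    each contributing at most [nu_tot d]. For the rest, at most [q * N] for each [x], the condition
    on [y] is dropped. *)
Lemma sum_isect_sqr : (\sum_(g | unimod g) isect g ^ 2 <=
  \sum_(d : R | d \is a GRing.unit) nu_tot d ^ 2 + #|E| * (q * N * (#|E| * q)))%N.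
Proof.
have -> : (\sum_(g | unimod g) isect g ^ 2 = \sum_(x in E) \sum_(y in E)
    \sum_(g | unimod g) (lincomb g x \in E) * (lincomb g y \in E))%N.
  under [in RHS]eq_bigr do rewrite exchange_big /=.
  rewrite exchange_big /=; apply: eq_bigr => g _.
  by rewrite -mulnn /isect big_distrlr.
have -> : (\sum_(d : R | d \is a GRing.unit) nu_tot d ^ 2 = \sum_(x in E)
    \sum_(y in E | det x y \is a GRing.unit) nu_tot (det x y))%N.
  transitivity (\sum_(d : R | d \is a GRing.unit) \sum_(x in E) \sum_(y in E)
      (det x y == d) * nu_tot d)%N.
    apply: eq_bigr => d _; rewrite -mulnn {1}/nu_tot big_distrl /=.
    by apply: eq_bigr => x _; rewrite /nu big_distrl.
  rewrite exchange_big /=; apply: eq_bigr => x _.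
  rewrite exchange_big /= [RHS]big_mkcondr /=; apply: eq_bigr => y _.
  case: ifP => [u|nu]; last first.
    by rewrite big1 // => d ud; case: eqP => // xy; rewrite xy ud in nu.
  rewrite (bigD1 (det x y)) //= eqxx mul1n big1 ?addn0 // => d /andP[_].
  by rewrite eq_sym => /negbTE->.
rewrite -sum_nat_const -big_split /=; apply: leq_sum => x xE.
rewrite -(card_det_nonunit (E_prim xE)) big_distrl /=.
rewrite (bigID (fun y => det x y \is a GRing.unit)) /=; apply: leq_add.
  by apply: leq_sum => y /andP[_ u]; apply: sum_unimod_pair_unit.
rewrite [X in (_ <= X)%N](bigID (mem E)) /=; apply: leq_trans (leq_addr _ _).
under [X in (_ <= X)%N]eq_bigl do rewrite andbC.
apply: leq_sum => y _; rewrite mul1n -(sum_unimod_mem (E_prim xE)).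
by apply: leq_sum => g _; case: (_ \in E); case: (_ \in E).
Qed.

(** The main terms [e ^+ 4 / Q] cancel. The constant 3 adds two errors from [sum_nu_tot_sqr] and one
    from pairs with non-unit determinant. *)
Lemma variance_isect :
  \sum_(g | unimod g) ((isect g)%:R - e ^+ 2 / Q ^+ 2) ^+ 2 <= 3 * e ^+ 2 * Q ^+ 2 * M.
Proof.
have Qp := card_ring_gt0; have nu2 := sum_nu_tot_sqr.
rewrite sum_sqr_center -natr_sum sum_isect !natrM -/e -/Q.
have : \sum_(g | unimod g) ((isect g)%:R : rat) ^+ 2 <=
    e ^+ 4 / Q + 2 * e ^+ 2 * Q ^+ 2 * M + e * (Q * M * (e * Q)).
  apply: le_trans (lerD nu2 (lexx _)).
  move: sum_isect_sqr; rewrite -(ler_nat rat) natrD !natrM !natr_sum -/e -/Q -/M.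
  under eq_bigr do rewrite natrX.
  by under [X in _ <= X + _ -> _]eq_bigr do rewrite natrX.
have -> : 2 * (e ^+ 2 / Q ^+ 2) * (e * (e * Q)) = 2 * (e ^+ 4 / Q) by field; rewrite gt_eqF.
have : (e ^+ 2 / Q ^+ 2) ^+ 2 * (\sum_(g : V * V | unimod g) 1)%:R <= e ^+ 4 / Q.
  have -> : e ^+ 4 / Q = (e ^+ 2 / Q ^+ 2) ^+ 2 * Q ^+ 3 by field; rewrite gt_eqF.
  by apply: ler_wpM2l; [apply: sqr_ge0 | rewrite -natrX ler_nat card_unimod].
lra.
Qed.

(* If [a > 2 m] then [a <= 2 (a - m)], so the deviation dominates. *)
Lemma expr_le_dev (a m b : rat) j : 0 <= a <= b -> 0 <= m ->
  a ^+ j.+2 <= (2 * m) ^+ j.+2 + 4 * b ^+ j * (a - m) ^+ 2.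
Proof.
move=> /andP[a0 ab] m0; have b0 := le_trans a0 ab.
have [am|ma] := leP a (2 * m).
  apply: (@le_trans _ _ ((2 * m) ^+ j.+2)); first by apply: lerXn2r; rewrite ?nnegrE ?mulr_ge0.
  by rewrite lerDl mulr_ge0 ?sqr_ge0 // mulr_ge0 // exprn_ge0.
apply: (@le_trans _ _ (b ^+ j * (4 * (a - m) ^+ 2))); last first.
  by rewrite mulrCA mulrA lerDr exprn_ge0 // mulr_ge0.
rewrite -addn2 exprD; apply: ler_pM; rewrite ?exprn_ge0 //.
  by apply: lerXn2r; rewrite ?nnegrE.
by nra.
Qed.

(** Sum [expr_le_dev] with [b = e] over at most [Q ^+ 3] matrices; 12 is 4 times the 3 of
    [variance_isect]. *)
Lemma moment_isect j :
  \sum_(g | unimod g) ((isect g)%:R : rat) ^+ j.+2 <=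
    Q ^+ 3 * (2 * (e ^+ 2 / Q ^+ 2)) ^+ j.+2 + 12 * e ^+ j.+2 * Q ^+ 2 * M.
Proof.
have Qp := card_ring_gt0; have e0 : 0 <= e by rewrite ler0n.
set m := e ^+ 2 / Q ^+ 2.
have m0 : 0 <= m by rewrite divr_ge0 ?exprn_ge0 // ltW.
have c0 : 0 <= (2 * m) ^+ j.+2 by rewrite exprn_ge0 // mulr_ge0.
have: forall g, ((isect g)%:R : rat) ^+ j.+2 <=
    (2 * m) ^+ j.+2 + 4 * e ^+ j * ((isect g)%:R - m) ^+ 2.
  by move=> g; apply: expr_le_dev => //; rewrite ler0n ler_nat isect_le.
move: ((2 * m) ^+ j.+2) c0 => c c0 dev.
apply: (@le_trans _ _ (\sum_(g : V * V | unimod g)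
    (c + 4 * e ^+ j * ((isect g)%:R - m) ^+ 2))).
  by apply: ler_sum => g _; apply: dev.
rewrite big_split /= -mulr_sumr; apply: lerD.
  rewrite (eq_bigr (fun g => 1%:R * c)) => [|g _]; last by rewrite mul1r.
  rewrite -mulr_suml -natr_sum; apply: ler_wpM2r => //.
  by rewrite -natrX ler_nat card_unimod.
have -> : 12 * e ^+ j.+2 * Q ^+ 2 * M = 4 * e ^+ j * (3 * e ^+ 2 * Q ^+ 2 * M).
  by rewrite -[j.+2]/(2 + j)%N exprD; ring.
by apply: ler_wpM2l variance_isect; rewrite mulr_ge0 ?exprn_ge0.
Qed.

End Variance.

(** * Counting functions and fibers *)

Section Counting.
Local Open Scope ring_scope.

Lemma card_ffun_pinned2 (T : finType) (j : nat) (i0 i1 : 'I_j.+2)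
    (A0 A1 B : {pred T}) : i0 != i1 ->
  #|[pred f : {ffun 'I_j.+2 -> T} | [&& f i0 \in A0, f i1 \in A1 &
      [forall i, (i != i0) && (i != i1) ==> (f i \in B)]]]|
  = (#|A0| * (#|A1| * #|B| ^ j))%N.
Proof.
move=> i01.
pose F i : {pred T} := if i == i0 then A0 else if i == i1 then A1 else B.
have i10 : (i1 == i0) = false by rewrite eq_sym (negbTE i01).
have -> : #|[pred f : {ffun 'I_j.+2 -> T} | [&& f i0 \in A0, f i1 \in A1 &
      [forall i, (i != i0) && (i != i1) ==> (f i \in B)]]]| = #|family F|.
  apply: eq_card => f; rewrite !inE; apply/and3P/familyP.
    case=> f0 f1 /forallP fB i; rewrite /F; case: eqP => [->//|/eqP n0].
    by case: eqP => [->//|/eqP n1]; have := fB i; rewrite n0 n1.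
  move=> fF; split; [by have := fF i0; rewrite /F eqxx| |].
    by have := fF i1; rewrite /F i10 eqxx.
  by apply/forallP => i; apply/implyP => /andP[/negbTE n0 /negbTE n1]; have := fF i; rewrite /F n0 n1.
rewrite card_family foldrE big_map big_enum /= (bigD1 i0) //= (bigD1 i1) /=; last by rewrite i10.
rewrite {1}/F eqxx {1}/F i10 eqxx; congr (_ * (_ * _))%N.
rewrite (eq_bigr (fun=> #|B|)); last by move=> i /andP[/negbTE n0 /negbTE n1]; rewrite /F n0 n1.
rewrite prod_nat_const; congr (_ ^ _)%N.
have := cardC (pred2 i0 i1); rewrite card2 i01 card_ord => /eqP.
rewrite (eqn_add2l 2 _ j) => /eqP; apply: etrans.
by apply: eq_card => i; rewrite !inE negb_or.
Qed.

(** Cauchy-Schwarz on the fiber sizes [h c], whose squares count pairs in a common fiber. *)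
Lemma sqr_card_le_fibers (T S : finType) (kappa : T -> S) (H : {set T}) (C : {set S}) :
  {in H, forall x, kappa x \in C} ->
  (#|H|%:R ^+ 2 : rat) <=
    #|C|%:R * (\sum_(x in H) \sum_(y in H) (kappa x == kappa y))%N%:R.
Proof.
move=> HC; pose h c := (\sum_(y in H) (c == kappa y))%N.
have -> : #|H|%:R = \sum_(c in C) ((h c)%:R : rat).
  rewrite -natr_sum exchange_big /= -sum1_card; congr _%:R; apply: eq_bigr => y yH.
  by rewrite (bigD1 (kappa y)) ?HC //= eqxx big1 // => c /andP[_ /negbTE->].
apply: le_trans (cauchy_schwarz_sum _ _) _; rewrite sum1_card.
apply: ler_wpM2l; first by rewrite ler0n.
rewrite (eq_bigr (fun c => (h c ^ 2)%:R)) => [|c _]; last by rewrite natrX.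
rewrite -natr_sum ler_nat.
have -> : (\sum_(c in C) h c ^ 2 = \sum_(c in C) \sum_(x in H) (c == kappa x) * h c)%N.
  by apply: eq_bigr => c _; rewrite -mulnn {1}/h big_distrl.
rewrite exchange_big /=; apply: leq_sum => x xH.
rewrite (bigD1 (kappa x)) ?HC //= eqxx mul1n [X in (_ + X)%N]big1 ?addn0 //.
by move=> c /andP[_ /negbTE->].
Qed.

End Counting.

(** * Pairs of configurations with equal determinants *)

Section Configurations.
Local Open Scope ring_scope.
Variable R : finComUnitRingType.
Notation V := (R * R)%type.
Notation q := #|R|.
Notation N := #|[pred d : R | d \isn't a GRing.unit]|.
Variable E : {set V}.
Hypothesis E_prim : {in E, forall x, primitive x}.
Variable j : nat.
Notation I := 'I_j.+2.
Implicit Types x y : {ffun I -> V}.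

Definition same_dets x y :=
  [forall i1, forall i2, det (x i1) (x i2) == det (y i1) (y i2)].

Variables i0 i1 : I.
Hypothesis i01 : i0 != i1.

Definition good_configs : {set {ffun I -> V}} :=
  [set x : {ffun I -> V} | [forall i, x i \in E] && (det (x i0) (x i1) \is a GRing.unit)].

(** By [unimod_transport], [y] is the image of [x] under some [g]. For fixed [g], each of the [j.+2]
    points of [x] independently has [isect E g] choices. *)
Lemma sum_same_dets_le :
  (\sum_(x in good_configs) \sum_(y in good_configs) same_dets x y <=
   \sum_(g | unimod g) isect E g ^ j.+2)%N.
Proof.
pose K (g : V * V) := [pred x : {ffun I -> V} | [forall i, (x i \in E) && (lincomb g (x i) \in E)]].
pose act (g : V * V) x : {ffun I -> V} := [ffun i => lincomb g (x i)].
apply: (@leq_trans (\sum_x \sum_y \sum_(g | unimod g) (x \in K g) * (y == act g x))%N).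
  rewrite big_mkcond /=; apply: leq_sum => x _; case: ifP => // xH.
  rewrite big_mkcond /=; apply: leq_sum => y _; case: ifP => // yH.
  case: (boolP (same_dets x y)) => // /forallP xy.
  move: xH yH; rewrite !inE => /andP[/forallP xE ux] /andP[/forallP yE uy].
  have dxy i i' : det (x i) (x i') = det (y i) (y i') by have /forallP/(_ i')/eqP := xy i.
  have [g g1 gz] := unimod_transport ux (esym (dxy i0 i1)).
  have gxy i : lincomb g (x i) = y i by apply: gz.
  rewrite (bigD1 g) /=; last by rewrite /unimod g1.
  have -> : y == act g x by apply/eqP/ffunP => i; rewrite ffunE gxy.
  by rewrite inE; have -> : [forall i, (x i \in E) && (lincomb g (x i) \in E)]
    by apply/forallP => i; rewrite gxy xE yE.
under eq_bigr do rewrite exchange_big /=.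
rewrite exchange_big /=; apply: leq_sum => g _.
have -> : isect E g = #|[pred z | (z \in E) && (lincomb g z \in E)]|.
  by rewrite /isect sum_bool sum1_card; apply: eq_card.
rewrite -[X in (_ ^ X)%N]card_ord -card_ffun_on -sum1_card [X in (_ <= X)%N]big_mkcond /=.
apply: leq_sum => x _; rewrite (bigD1 (act g x)) //= eqxx big1 => [|y /negbTE->]; last by rewrite muln0.
by rewrite addn0 muln1; case: (boolP (x \in K g)).
Qed.

(** In a bad configuration, once [x i0] is chosen in [E], the point [x i1] lies among [q * N] points
    of the plane and the other [j] points are free in [E]. *)
Lemma card_good_configs :
  (#|E| ^ j.+2 <= #|good_configs| + #|E| ^ j.+1 * (q * N))%N.
Proof.
have -> : (#|E| ^ j.+2 = #|[pred x : {ffun I -> V} | [forall i, x i \in E]]|)%N.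
  rewrite -[X in (_ ^ X)%N]card_ord -card_ffun_on; apply: eq_card => x.
  by apply/ffun_onP/forallP.
rewrite -[X in (X <= _)%N](cardID (mem good_configs)); apply: leq_add.
  by apply: subset_leq_card; apply/subsetP => x; rewrite !inE => /andP[].
rewrite expnS -mulnA -(sum_nat_const (mem E)) -[X in (X <= _)%N]sum1_card.
rewrite (partition_big (fun x : {ffun I -> V} => x i0) (mem E)) /=; last first.
  by move=> x; rewrite !inE => /andP[_ /forallP].
apply: leq_sum => a aE.
have -> : (#|E| ^ j * (q * N) = #|pred1 a| * (#|[pred z | det a z \isn't a GRing.unit]| * #|E| ^ j))%N.
  by rewrite card1 mul1n -(card_det_nonunit (E_prim aE)) sum1_card mulnC.
rewrite -(card_ffun_pinned2 _ _ _ i01) sum1_card.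
apply: subset_leq_card; apply/subsetP => x.
rewrite unfold_in /= !inE => /andP[/andP[nH xE] /eqP x0].
rewrite x0 eqxx /=; apply/andP; split; first by move: nH; rewrite xE x0.
by apply/forallP => i; apply/implyP => _; move/forallP: xE.
Qed.

End Configurations.

(** * Upper bound: a normal form for the determinants of a configuration *)

Section NormalForm.
Local Open Scope ring_scope.
Variable R : finComUnitRingType.
Notation V := (R * R)%type.
(** The valuation ring property; the argument of type [I] witnesses that the family is nonempty. *)
Hypothesis exists_common_divisor : forall (I : finType) (f : I -> R), I ->
  exists i0, forall i, exists c, f i = c * f i0.
Variable j : nat.
Notation I := 'I_j.+2.

(* Row reduction: [(x i0).1] divides all coordinates, and after clearing the second
   coordinate of [x i0] a second pivot [i1] is chosen in the second column. *)
Lemma det_normal_form_pivot (x : I -> V) i0 :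
  (forall i, exists a, (x i).1 = a * (x i0).1) ->
  (forall i, exists a, (x i).2 = a * (x i0).1) ->
  exists i1 D (f : {ffun I -> V}),
    [/\ i0 != i1, f i0 = (1, 0), f i1 = (0, 1) &
        forall i i', det (x i) (x i') = D * det (f i) (f i')].
Proof.
move=> /fin_all_exists[a0 a0E] /fin_all_exists[t tE].
pose s := (x i0).1.
(* Quotients are not unique when [s] is a zero divisor, so the value 1 at [i0] is imposed. *)
pose a i := if i == i0 then 1 else a0 i.
have aE i : (x i).1 = a i * s.
  by rewrite /a; case: eqP => [->|_]; rewrite ?mul1r.
pose y i := (x i).2 - t i0 * (x i).1.
have y0 : y i0 = 0 by rewrite /y tE subrr.
have [i1 i01 /fin_all_exists[c0 c0E]] : exists2 i1, i0 != i1 & forall i, exists c, y i = c * y i1.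
  have [i1 H] := exists_common_divisor y i0.
  (* If the divisor sits at [i0], where [y] vanishes, then all of [y] is zero and any other index
     serves. *)
  have [i1E|n1] := eqVneq i0 i1; last by exists i1.
  have [i2 n2] : exists i2, i0 != i2.
    have [->|n0] := eqVneq i0 ord0; first by exists ord_max.
    by exists ord0.
  exists i2 => // i; exists 0; rewrite mul0r.
  by have [c ->] := H i; rewrite -i1E y0 mulr0.
pose c i := if i == i0 then 0 else if i == i1 then 1 else c0 i.
have i10 : (i1 == i0) = false by rewrite eq_sym (negbTE i01).
have cE i : y i = c i * y i1.
  rewrite /c; case: eqP => [->|_]; first by rewrite y0 mul0r.
  by case: eqP => [->|_]; rewrite ?mul1r.
(* The shear by [a i1] preserves determinants and brings [f i1] to [(0, 1)]. *)
pose f : {ffun I -> V} := [ffun i => (a i - a i1 * c i, c i)].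
exists i1, (s * y i1), f; split => //.
- by rewrite ffunE /a /c eqxx mulr0 subr0.
- by rewrite ffunE {2}/c /c i10 eqxx mulr1 subrr.
move=> i i'; transitivity ((x i).1 * y i' - y i * (x i').1).
  by rewrite /det /y; ring.
by rewrite !ffunE (cE i) (cE i') !aE /det /=; ring.
Qed.

(** A coordinate dividing all others exists. If it is a second coordinate, a quarter turn makes it a
    first one up to signs elsewhere and keeps determinants. *)
Lemma det_normal_form (x : I -> V) :
  exists i0 i1 D (f : {ffun I -> V}),
    [/\ i0 != i1, f i0 = (1, 0), f i1 = (0, 1) &
        forall i i', det (x i) (x i') = D * det (f i) (f i')].
Proof.
pose F (ib : I * bool) := if ib.2 then (x ib.1).1 else (x ib.1).2.
have [[i0 []] /= H] := exists_common_divisor F (ord0, true).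
  by exists i0; apply: det_normal_form_pivot => i; [exact: (H (i, true)) | exact: (H (i, false))].
have [||i1 [D [f [i01 f0 f1 fE]]]] := @det_normal_form_pivot (fun i => (- (x i).2, (x i).1)) i0.
- by move=> i; have [a aE] := H (i, false); exists a; rewrite /= mulrN -aE.
- by move=> i; have [a aE] := H (i, true); exists (- a); rewrite /= mulrNN -aE.
by exists i0, i1, D, f; split=> // i i'; rewrite -fE det_perp.
Qed.

Definition det_matrix (x : {ffun I -> V}) : {ffun I * I -> R} :=
  [ffun ij => det (x ij.1) (x ij.2)].

(** The matrix is determined by the pivots [i0], [i1], the scalar [D], and the [j] points of [f]
    that are not pinned. *)
Lemma card_det_matrix :
  (#|[set det_matrix x | x : {ffun I -> V}]| <= j.+2 ^ 2 * #|R| ^ (2 * j).+1)%N.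
Proof.
pose pinned (ij : I * I) := [pred f : {ffun I -> V} |
  [&& f ij.1 \in pred1 (1, 0), f ij.2 \in pred1 (0, 1) &
      [forall i, (i != ij.1) && (i != ij.2) ==> (f i \in predT)]]].
pose B := [set t : (I * I) * (R * {ffun I -> V}) |
  (t.1.1 != t.1.2) && (t.2.2 \in pinned t.1)].
pose theta (t : (I * I) * (R * {ffun I -> V})) : {ffun I * I -> R} :=
  [ffun ij => t.2.1 * det (t.2.2 ij.1) (t.2.2 ij.2)].
apply: (@leq_trans #|[set theta t | t in B]|).
  apply/subset_leq_card/subsetP => _ /imsetP[x _ ->].
  have [i0 [i1 [D [f [i01 f0 f1 fE]]]]] := det_normal_form x.
  apply/imsetP; exists ((i0, i1), (D, f)).
    by rewrite !inE /= i01 f0 f1 !eqxx /=; apply/forallP => i; apply/implyP.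
  by apply/ffunP => ij; rewrite !ffunE fE.
apply: leq_trans (leq_imset_card _ _) _.
rewrite -sum1dep_card.
rewrite -(pair_big_dep (fun ij : I * I => ij.1 != ij.2) (fun ij t => t.2 \in pinned ij) (fun _ _ => 1%N)) /=.
apply: (@leq_trans (\sum_(ij : I * I) #|R| ^ (2 * j).+1)); last first.
  by rewrite sum_nat_const card_prod card_ord.
rewrite big_mkcond /=; apply: leq_sum => -[i0 i1] _ /=; case: ifP => // i01.
rewrite -(pair_big_dep predT (fun _ f => f \in pinned (i0, i1)) (fun _ _ => 1%N)) /=.
rewrite sum_nat_const expnS leq_mul2l; apply/orP; right.
rewrite sum1_card card_ffun_pinned2 // !card1 !mul1n expnM -mulnn.
by rewrite -card_prod; apply: eq_leq; congr (_ ^ _)%N; apply: eq_card.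
Qed.

End NormalForm.

(** * The ring of integers modulo a prime power *)

Section PrimePower.
Local Open Scope ring_scope.
Variables p l : nat.
Hypotheses (p_prime : prime p) (l_gt0 : (0 < l)%N).
Notation n := (p ^ l)%N.

Lemma prime_power_gt1 : (1 < n)%N.
Proof. by rewrite -(exp1n l) ltn_exp2r // prime_gt1. Qed.

Lemma card_Zn : #|'Z_n| = n.
Proof. by rewrite card_ord Zp_cast // prime_power_gt1. Qed.

Lemma card_nonunit_Zn : (p * #|[pred d : 'Z_n | d \isn't a GRing.unit]| = n)%N.
Proof.
have n0 : (0 < n)%N by apply: ltnW prime_power_gt1.
have uE : (\sum_(d : 'Z_n | d \is a GRing.unit) 1 = totient n)%N.
  by rewrite -(card_units_Zp n0) cardsT card_sub sum1_card.
have := card_units_nonunits 'Z_n; rewrite uE card_Zn totient_pfactor //.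
have pE : (p = p.-1.+1)%N by rewrite prednK // prime_gt0.
have lE : n = (p * p ^ l.-1)%N by rewrite -expnS prednK.
rewrite [in RHS]lE; set N := #|_|; rewrite {3}pE mulSn addnC => /addIn ->.
by rewrite -lE.
Qed.

(** Divisors of [n] are powers of [p], so comparing gcds decides divisibility; by Bezout [gcdn a n]
    is a multiple of [a] modulo [n]. *)
Lemma dvd_Zn (a b : 'Z_n) : (gcdn a n <= gcdn b n)%N -> exists c, b = c * a.
Proof.
move=> ab; have n1 := prime_power_gt1.
have : (gcdn a n %| b)%N.
  apply: dvdn_trans (dvdn_gcdl b n).
  have [u _ uE] := dvdn_pfactor _ l p_prime (dvdn_gcdr a n).
  have [v _ vE] := dvdn_pfactor _ l p_prime (dvdn_gcdr b n).
  by rewrite uE vE dvdn_exp2l // -(leq_exp2l _ _ (prime_gt1 p_prime)) -uE -vE.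
case/dvdnP => m bE.
have [k _ /dvdnP[r rE]] := Bezoutl a (ltnW n1).
exists (- (m%:R * k%:R)).
have : ((gcdn n a)%:R : 'Z_n) + k%:R * a = 0.
  by rewrite -{2}[a]natr_Zp -natrM -natrD rE natrM pchar_Zp // mulr0.
move/eqP; rewrite addr_eq0 => /eqP gE.
by rewrite -[LHS]natr_Zp bE natrM gcdnC gE; ring.
Qed.

Lemma exists_common_divisor_Zn (I : finType) (f : I -> 'Z_n) : I ->
  exists i0, forall i, exists c, f i = c * f i0.
Proof.
move=> i; case: (arg_minnP (P := predT) (fun i => gcdn (f i) n) (erefl : predT i)) => i0 _ H.
by exists i0 => i'; apply: dvd_Zn; apply: H.
Qed.

Lemma card_classes_setT j :
  (#|classes j.+1 [set: pt n]| <= j.+2 ^ 2 * n ^ (2 * j).+1)%N.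
Proof.
have := card_det_matrix exists_common_divisor_Zn j; rewrite card_Zn.
apply: leq_trans.
pose psi (M : {ffun 'I_j.+2 * 'I_j.+2 -> 'Z_n}) : {set config n j.+1} :=
  [set y | det_matrix y == M].
apply: (@leq_trans #|[set psi M | M in [set det_matrix x | x : config n j.+1]]|); last first.
  exact: leq_imset_card.
apply/subset_leq_card/subsetP => _ /imsetP[x _ ->].
apply/imsetP; exists (det_matrix x); first exact: imset_f.
apply/setP => y; rewrite !inE.
have -> /= : [forall i, y i \in [set: pt n]] by apply/forallP => i; rewrite inE.
apply/forallP/eqP => [xy|/ffunP yx i].
  by apply/ffunP => -[i i']; rewrite !ffunE /=; have /forallP/(_ i')/eqP := xy i.
by apply/forallP => i'; apply/eqP; have := yx (i, i'); rewrite !ffunE.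
Qed.

End PrimePower.

(** * Lower bound for the number of classes *)

Section LowerBound.
Local Open Scope ring_scope.
Variables p l j : nat.
Hypotheses (p_prime : prime p) (l_gt0 : (0 < l)%N).
Notation n := (p ^ l)%N.
Notation N := #|[pred d : 'Z_n | d \isn't a GRing.unit]|.

Lemma sqr_card_good_configs (E : {set pt n}) (i0 i1 : 'I_j.+2) :
  (#|good_configs E i0 i1|%:R ^+ 2 : rat) <=
    #|classes j.+1 E|%:R * (\sum_(g | unimod g) isect E g ^ j.+2)%N%:R.
Proof.
pose kappa (x : config n j.+1) := [set y in configs j.+1 E | cfg_equiv x y].
have goodE (x : config n j.+1) : x \in good_configs E i0 i1 -> x \in configs j.+1 E.
  by rewrite !inE => /andP[].
have kappa_in : {in good_configs E i0 i1, forall x, kappa x \in classes j.+1 E}.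
  by move=> x /goodE xE; apply/imsetP; exists x.
apply: le_trans (sqr_card_le_fibers kappa_in) _.
apply: ler_wpM2l; first by rewrite ler0n.
rewrite ler_nat; apply: leq_trans (sum_same_dets_le E i0 i1).
apply: leq_sum => x xH; apply: leq_sum => y yH.
case: eqP => // /setP/(_ y); rewrite !inE.
have -> : [forall i, y i \in E] by have := goodE _ yH; rewrite inE.
have -> : cfg_equiv y y by apply/forallP => i; apply/forallP => i'.
by move=> /= xy; rewrite lt0b; exact: xy.
Qed.

(** With [X = #|E| ^ j.+2], at least [X / 2] configurations are good, and density makes the moment
    at most [X ^+ 2 * n ^+ 3 / B] times a constant. Cancelling [X ^+ 2] leaves [B / n ^+ 3], the
    claimed power of [n]. *)
Lemma card_classes_primitive (E : {set pt n}) :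
  {in E, forall x, primitive x} -> (2 * (n * N) <= #|E|)%N ->
  (n ^ (2 * j.+2) <= p * #|E| ^ j.+2)%N ->
  (n ^ (2 * j).+1 <= 4 * (2 ^ j.+2 + 12) * #|classes j.+1 E|)%N.
Proof.
move=> E_prim E_big E_dense; pose i0 : 'I_j.+2 := ord0; pose i1 : 'I_j.+2 := ord_max.
have i01 : i0 != i1 by [].
have CS := sqr_card_good_configs E i0 i1.
have mom := moment_isect E_prim j.
have good := card_good_configs E_prim i01.
rewrite card_Zn // in mom good.
have pN := card_nonunit_Zn p_prime l_gt0.
set e := #|E| in E_big E_dense mom good *; set H := #|_| in CS good.
set C := #|classes _ _| in CS *; set M := N in E_big mom good pN.
have n0 : (0 < n)%N by apply: ltnW (prime_power_gt1 p_prime l_gt0).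
have p0 := prime_gt0 p_prime.
have good2 : (e ^ j.+2 <= 2 * H)%N.
  have : (2 * (e ^ j.+1 * (n * M)) <= e ^ j.+2)%N.
    by rewrite mulnCA [in X in (_ <= X)%N]expnSr leq_mul2l E_big orbT.
  by lia.
set X := (e ^ j.+2)%N in good2 E_dense.
have X0 : (0 < X)%N.
  rewrite lt0n; apply: contraTneq E_dense => ->.
  by rewrite muln0 -ltnNge expn_gt0 n0.
rewrite -(ler_nat rat).
move: mom.
set S := (\sum_(g | unimod g) isect E g ^ j.+2)%N in CS.
rewrite (eq_bigr (fun g => (isect E g ^ j.+2)%:R)) => [|g _]; last by rewrite natrX.
rewrite -natr_sum -/S => mom.
have Xr : (0 : rat) < X%:R by rewrite ltr0n.
have nr : (0 : rat) < n%:R by rewrite ltr0n.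
have pr : (0 : rat) < p%:R by rewrite ltr0n.
pose B : rat := n%:R ^+ (2 * j.+2).
have B0 : 0 < B by apply: exprn_gt0.
have dense : B <= p%:R * X%:R by rewrite /B -natrX -natrM ler_nat.
have Mr : (M%:R : rat) = n%:R / p%:R.
  by rewrite -[in RHS]pN natrM; field; rewrite gt_eqF.
have CS' : (X%:R : rat) ^+ 2 / 4 <= C%:R * S%:R.
  apply: le_trans CS.
  have : (X%:R : rat) <= 2 * H%:R by rewrite -natrM ler_nat.
  by move: (ler0n rat H) Xr; nra.
have mom' : (S%:R : rat) <= X%:R ^+ 2 * (n%:R ^+ 3 / B) * (2 ^+ j.+2 + 12).
  apply: le_trans mom _.
  have -> : (n%:R : rat) ^+ 3 * (2 * (e%:R ^+ 2 / n%:R ^+ 2)) ^+ j.+2 =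
      X%:R ^+ 2 * (n%:R ^+ 3 / B) * 2 ^+ j.+2.
    rewrite exprMn expr_div_n exprAC -(natrX _ e) -/X /B exprM.
    by ring.
  rewrite [X in _ <= X]mulrDr lerD2l Mr -natrX -/X.
  have -> : 12 * X%:R * n%:R ^+ 2 * (n%:R / p%:R) =
      X%:R * n%:R ^+ 3 * 12 * (p%:R^-1 : rat) by ring.
  have -> : X%:R ^+ 2 * (n%:R ^+ 3 / B) * 12 =
      X%:R * n%:R ^+ 3 * 12 * (X%:R / B : rat) by ring.
  (* What remains is [1 / p <= X / B], which is the density hypothesis. *)
  apply: ler_wpM2l; first by rewrite !mulr_ge0 ?exprn_ge0 // ltW.
  by rewrite ler_pdivlMr // mulrC ler_pdivrMr // mulrC.
have key : (X%:R ^+ 2 : rat) / 4 <= X%:R ^+ 2 * (C%:R * (n%:R ^+ 3 / B) * (2 ^+ j.+2 + 12)).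
  apply: le_trans CS' _; apply: le_trans (ler_wpM2l (ler0n _ _) mom') _.
  by rewrite le_eqVlt; apply/orP; left; apply/eqP; ring.
have : (4^-1 : rat) <= C%:R * (n%:R ^+ 3 / B) * (2 ^+ j.+2 + 12).
  by rewrite -(ler_pM2l (exprn_gt0 2 Xr)).
have -> : B = n%:R ^+ (2 * j).+1 * n%:R ^+ 3.
  by rewrite /B -exprD !mulnS [(_ + 3)%N]addnC.
rewrite !natrM natrD (natrX _ n) (natrX _ 2).
set Y := n%:R ^+ (2 * j).+1; have Y0 : 0 < Y by apply: exprn_gt0.
have -> : (n%:R : rat) ^+ 3 / (Y * n%:R ^+ 3) = Y^-1 by field; rewrite !gt_eqF.
set K := 2 ^+ _ + 12.
have -> : C%:R / Y * K = (C%:R * K) / Y by ring.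
rewrite ler_pdivlMr //; lra.
Qed.

Lemma card_nonunit_fst (E : {set pt n}) :
  (#|E| <= #|[set x in E | x.1 \is a GRing.unit]| + n * N)%N.
Proof.
rewrite -(cardsID [set x : pt n | x.1 \is a GRing.unit] E).
apply: leq_add; first by apply: subset_leq_card; apply/subsetP => x; rewrite !inE.
have -> : (n * N = #|[set x : pt n | x.1 \isn't a GRing.unit]|)%N.
  have -> : [set x : pt n | x.1 \isn't a GRing.unit] =
      setX [set d : 'Z_n | d \isn't a GRing.unit] [set: 'Z_n].
    by apply/setP => x; rewrite !inE andbT.
  by rewrite cardsX cardsT cardsE card_Zn // mulnC.
by apply: subset_leq_card; apply/subsetP => x; rewrite !inE => /andP[].
Qed.

(** Intersecting with the configurations in [E] maps some class in [F] onto each class in [E]. *)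
Lemma subset_classes (E F : {set pt n}) k : E \subset F ->
  (#|classes k E| <= #|classes k F|)%N.
Proof.
move=> /subsetP EF.
pose restr (c : {set config n k}) := c :&: configs k E.
apply: (@leq_trans #|[set restr c | c in classes k F]|); last exact: leq_imset_card.
apply/subset_leq_card/subsetP => _ /imsetP[x xE ->]; apply/imsetP.
have sub : configs k E \subset configs k F.
  by apply/subsetP => y; rewrite !inE => /forallP yE; apply/forallP => i; apply: EF.
exists [set y in configs k F | cfg_equiv x y].
  by apply/imsetP; exists x => //; apply: (subsetP sub).
apply/setP => y; rewrite in_setI [in LHS]inE [in RHS]in_set andbC.
by case: (boolP (y \in configs k E)) => [/(subsetP sub)->|]; rewrite ?andbF ?andbT.
Qed.

(** Points with unit first coordinate are primitive. Discarding the others removes at most a quarter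
    of [E], and the factor [4 ^ j.+2] absorbs the loss. *)
Lemma card_classes_dense (E : {set pt n}) :
  (4 ^ j.+2 * n ^ (2 * j.+2) <= p * #|E| ^ j.+2)%N ->
  (n ^ (2 * j).+1 <= 4 * (2 ^ j.+2 + 12) * #|classes j.+1 E|)%N.
Proof.
move=> E_dense; pose F := [set x in E | x.1 \is a GRing.unit].
have FE : F \subset E by apply/subsetP => x; rewrite inE => /andP[].
have F_prim : {in F, forall x, primitive x}.
  move=> x; rewrite inE => /andP[_ ux]; apply/existsP; exists (0, x.1^-1).
  by rewrite /det /= mulrV // mulr0 subr0.
have EF := card_nonunit_fst E; rewrite -/F in EF.
have pN := card_nonunit_Zn p_prime l_gt0.
have n0 : (0 < n)%N by apply: ltnW (prime_power_gt1 p_prime l_gt0).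
have p0 := prime_gt0 p_prime.
(* Otherwise, as [p * N = n] and [p <= p ^ j.+2], the density bound would fail. *)
have E_big : (4 * (n * N) <= #|E|)%N.
  rewrite leqNgt; apply/negP => small; move: E_dense; apply/negP; rewrite -ltnNge.
  have small' : (#|E| ^ j.+2 < (4 * (n * N)) ^ j.+2)%N by rewrite ltn_exp2r.
  apply: (@leq_trans (p * (4 * (n * N)) ^ j.+2)%N); first by rewrite ltn_pmul2l.
  rewrite expnMn mulnCA leq_mul2l; apply/orP; right.
  rewrite expnM expnMn -mulnn expnMn mulnCA leq_mul2l; apply/orP; right.
  rewrite -[X in (_ <= X ^ _)%N]pN expnMn leq_mul2r; apply/orP; right.
  by rewrite -{1}[p]expn1 leq_pexp2l.
apply: leq_trans (leq_mul (leqnn _) (subset_classes j.+1 FE)).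
apply: card_classes_primitive => //; first by lia.
have : (#|E| ^ j.+2 <= (2 * #|F|) ^ j.+2)%N by rewrite leq_exp2r //; lia.
rewrite expnMn => EF2.
have : (2 ^ j.+2 * n ^ (2 * j.+2) <= 4 ^ j.+2 * n ^ (2 * j.+2))%N.
  by rewrite leq_mul2r leq_exp2r ?orbT.
move=> h; rewrite -(leq_pmul2l (_ : 0 < 2 ^ j.+2)%N) ?expn_gt0 //.
apply: leq_trans h _; apply: leq_trans E_dense _.
by rewrite mulnCA leq_mul2l EF2 orbT.
Qed.

Lemma card_classes_setT_le (E : {set pt n}) :
  (4 ^ j.+2 * n ^ (2 * j.+2) <= p * #|E| ^ j.+2)%N ->
  (#|classes j.+1 [set: pt n]| <=
     j.+2 ^ 2 * (4 * (2 ^ j.+2 + 12)) * #|classes j.+1 E|)%N.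
Proof.
move=> /card_classes_dense dense.
apply: leq_trans (card_classes_setT p_prime l_gt0 j) _.
by rewrite -mulnA leq_mul2l dense orbT.
Qed.

End LowerBound.

(* Real exponents and the conclusion *)
From Stdlib Require Import Reals Lra.

Lemma INR_muln a b : INR (muln a b) = (INR a * INR b)%R.
Proof. exact: mult_INR. Qed.

Lemma INR_expn a b : INR (expn a b) = (INR a ^ b)%R.
Proof. by elim: b => // b IH; rewrite expnS INR_muln IH. Qed.

Lemma Rpower_ge1 x a : (1 <= x)%R -> (0 <= a)%R -> (1 <= Rpower x a)%R.
Proof. by move=> x1 a0; rewrite -(Rpower_O x); [apply: Rle_Rpower | Lra.lra]. Qed.

(** The exponents add up to [1 + l n (2 - 1 / (l n)) = 2 l n]: the saving in the exponent is exactly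
    one factor [p]. *)
Lemma Rpower_exponent_pow (p l n : nat) : (0 < INR p)%R -> (0 < INR l)%R ->
  (0 < INR n)%R ->
  (INR p * Rpower (INR p) (INR l * (2 - 1 / (INR l * INR n))) ^ n
   = INR (expn (expn p l) (2 * n)))%R.
Proof.
move=> p0 l0 n0.
rewrite -Rpower_pow; last by apply: exp_pos.
rewrite Rpower_mult -{1}[INR p]Rpower_1 // -Rpower_plus -expnM INR_expn -Rpower_pow //.
congr Rpower; rewrite !INR_muln /=; field; split; Lra.lra.
Qed.

Theorem theorem2 :
  forall k : nat, (1 <= k)%N ->
  exists C c : R, (0 < C)%R /\ (0 < c)%R /\
  forall (p l : nat) (E : {set pt (expn p l)}),
    prime p -> odd p -> (1 <= l)%N ->
    (C * Rpower (INR l) (2 / INR k.+1)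
       * Rpower (INR p) (INR l * (2 - 1 / (INR l * INR k.+1))) <= INR #|E|)%R ->
    (c * INR #|classes k [set: pt (expn p l)]| <= INR #|classes k E|)%R.
Proof.
case=> [//|j] _.
set K := (muln (expn j.+2 2) (muln 4 (addn (expn 2 j.+2) 12))).
have K0 : (0 < INR K)%R.
  by apply: lt_0_INR; apply/ssrnat.ltP; rewrite /K !muln_gt0 addn_gt0 orbT.
(* The constant 4 becomes the [4 ^ j.+2] of the density condition after raising to the power
   [k + 1 = j.+2]. *)
exists 4%R, (/ INR K)%R; split; [Lra.lra | split; [exact: Rinv_0_lt_compat |]].
move=> p l E p_prime _ l_gt0 E_big.
have p0 : (0 < INR p)%R by apply: lt_0_INR; apply/ssrnat.ltP; apply: prime_gt0.
have l1 : (1 <= INR l)%R by apply: (le_INR 1); apply/ssrnat.leP.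
have n0 : (0 < INR j.+2)%R by apply: lt_0_INR; apply/ssrnat.ltP.
set P := Rpower (INR p) _ in E_big.
have P0 : (0 < P)%R by apply: exp_pos.
have L1 : (1 <= Rpower (INR l) (2 / INR j.+2))%R.
  by apply: Rpower_ge1 => //; apply: Rlt_le; apply: Rdiv_lt_0_compat => //; Lra.lra.
have E_ge : (4 * P <= INR #|E|)%R.
  by apply: Rle_trans E_big; apply: Rmult_le_compat_r; Lra.lra.
have E_pow : (4 ^ j.+2 * P ^ j.+2 <= INR #|E| ^ j.+2)%R.
  by rewrite -Rpow_mult_distr; apply: pow_incr; Lra.lra.
have dense : (expn 4 j.+2 * expn (expn p l) (2 * j.+2) <= p * expn #|E| j.+2)%N.
  apply/ssrnat.leP; apply: INR_le; rewrite !(INR_muln _ (expn _ _)) -Rpower_exponent_pow //; last Lra.lra.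
  rewrite -/P !INR_expn (_ : INR 4 = 4%R); last by rewrite /=; Lra.lra.
  by move: (Rmult_le_compat_l _ _ _ (Rlt_le _ _ p0) E_pow); Lra.lra.
have /ssrnat.leP/le_INR := card_classes_setT_le p_prime l_gt0 dense.
rewrite -/K INR_muln => H.
by apply: (Rmult_le_reg_l (INR K)) => //; rewrite -Rmult_assoc Rinv_r ?Rmult_1_l //; Lra.lra.
Qed.
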